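(* Let $\mathfrak{X}=(X,\{R_i\}_{i=0}^d)$ be a symmetric association scheme of class $d$, with adjacency matrices $A_0,\dots,A_d$, primitive idempotents $E_0,\dots,E_d$ (with $E_0=\frac{1}{|X|}J$), first eigenmatrix entries $P_i(j)$ and second eigenmatrix entries $Q_i(j)$. Put $\theta_i=P_1(i)$ for $0\le i\le d$, and suppose that $\theta_0,\theta_1,\dots,\theta_d$ are mutually distinct. Then the following are equivalent: (1) $\mathfrak{X}$ is a $P$-polynomial association scheme with respect to $A_1$. (2) There exists $l\in\{0,1,\dots,d\}$ such that for each $i\in\{1,2,\dots,d\}$, \[\prod_{\substack{j=1\\ j\neq i}}^{d}\frac{\theta_0-\theta_j}{\theta_i-\theta_j}=-Q_i(l).\] Moreover, if (2) holds, then $A_l$ is the $d$-th adjacency matrix in the $P$-polynomial ordering, i.e. in the ordering $A_0,A_1,A_{\xi_2},\dots,A_{\xi_d}$ witnessing the $P$-polynomial property one has $\xi_d=l$.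
   Context: A symmetric association scheme $\mathfrak{X}=(X,\{R_i\}_{i=0}^d)$ of class $d$ consists of a finite set $X$ and binary relations $R_0,\dots,R_d$ on $X$ such that $R_0=\{(x,x):x\in X\}$, the $R_i$ partition $X\times X$, each $R_i$ is symmetric, and for all $i,j,k$ the number $p^k_{i,j}=|\{z:(x,z)\in R_i,(z,y)\in R_j\}|$ is independent of the choice of $(x,y)\in R_k$. The adjacency matrix $A_i$ is the $X\times X$ 0/1 matrix with $A_i(x,y)=1$ iff $(x,y)\in R_i$; the valency is $k_i=p^0_{i,i}$. The Bose–Mesner algebra spanned by $A_0,\dots,A_d$ is commutative and semisimple and has a basis of primitive idempotents $E_0=\frac1{|X|}J,E_1,\dots,E_d$ (with $\sum E_i=I$, $E_iE_j=\delta_{ij}E_i$); $m_i=\mathrm{rank}\,E_i$. The first and second eigenmatrices are defined by $A_i=\sum_{j}P_i(j)E_j$ and $E_i=\frac1{|X|}\sum_j Q_i(j)A_j$. The scheme is $P$-polynomial with respect to an ordering $A_0,A_1,\dots,A_d$ if for each $i$ there is a polynomial $v_i$ of degree $i$ with $P_i(j)=v_i(P_1(j))$ for all $j$ (equivalently $A_i=v_i(A_1)$); it is $P$-polynomial with respect to $A_1$ if it is $P$-polynomial with respect to some ordering $A_0,A_1,A_{\xi_2},\dots,A_{\xi_d}$ of its adjacency matrices. *)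

(* Defs.v *)
From HB Require Import structures.
From mathcomp Require Import all_boot all_order all_fingroup all_algebra.
From mathcomp Require Import reals.
Set Implicit Arguments.
Unset Strict Implicit.
Unset Printing Implicit Defensive.
Import GRing.Theory Num.Theory.
Local Open Scope ring_scope.

(* As in any partition, the classes R_i are required to be nonempty. *)
Record sym_assoc_scheme (X : finType) (d : nat) := SymAssocScheme {
  scheme_rel :> 'I_d.+1 -> rel X;
  scheme_diag : forall x y, scheme_rel ord0 x y = (x == y);
  scheme_nonempty : forall i, exists x y, scheme_rel i x y;
  scheme_partition : forall x y, exists! i, scheme_rel i x y;
  scheme_sym : forall i x y, scheme_rel i x y = scheme_rel i y x;
  scheme_regular : forall i j k x y x' y',
    scheme_rel k x y -> scheme_rel k x' y' ->
    #|[set z | scheme_rel i x z & scheme_rel j z y]| =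
    #|[set z | scheme_rel i x' z & scheme_rel j z y']|
}.

Section BoseMesner.
Variables (R : realType) (X : finType) (d : nat) (S : sym_assoc_scheme X d).

(* X-by-X matrices are indexed by 'I_#|X| through the enumeration of X. *)
Definition adjacency_mx (i : 'I_d.+1) : 'M[R]_#|X| :=
  \matrix_(x, y) (S i (enum_val x) (enum_val y))%:R.

(* The span is closed under the matrix product because S is a scheme. *)
Definition bose_mesner : {vspace 'M[R]_#|X|} :=
  <<[seq adjacency_mx i | i : 'I_d.+1]>>%VS.

Definition primitive_idempotent (B : {vspace 'M[R]_#|X|}) (e : 'M[R]_#|X|) :=
  [/\ e \in B, e != 0, e *m e = e &
      forall f, f \in B -> f *m f = f -> e *m f = f -> f *m e = f ->
        f = 0 \/ f = e].

Record primitive_idempotents (E : 'I_d.+1 -> 'M[R]_#|X|) : Prop := {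
  pidem0 : E ord0 = #|X|%:R^-1 *: const_mx 1;
  pidem_primitive : forall i, primitive_idempotent bose_mesner (E i);
  pidem_basis : basis_of bose_mesner [seq E i | i : 'I_d.+1];
  pidem_sum : \sum_i E i = 1%:M;
  pidem_orth : forall i j, E i *m E j = if i == j then E i else 0
}.

(* P i j and Q i j stand for P_i(j) and Q_i(j): the subscript comes first. *)
Definition first_eigenmatrix (E : 'I_d.+1 -> 'M[R]_#|X|)
    (P : 'I_d.+1 -> 'I_d.+1 -> R) :=
  forall i, adjacency_mx i = \sum_j P i j *: E j.

Definition second_eigenmatrix (E : 'I_d.+1 -> 'M[R]_#|X|)
    (Q : 'I_d.+1 -> 'I_d.+1 -> R) :=
  forall i, E i = #|X|%:R^-1 *: \sum_j Q i j *: adjacency_mx j.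

End BoseMesner.

Section PPolynomial.
Variables (R : realType) (d : nat) (P : 'I_d.+1 -> 'I_d.+1 -> R).

(* The ordering is A_(xi 0) = A_0, A_(xi 1), ..., A_(xi d). For d > 0,
   inord 1 is the index 1. *)
Definition P_polynomial_ordering (xi : 'S_d.+1) :=
  xi ord0 = ord0 /\
  forall i : 'I_d.+1, exists v : {poly R},
    size v = i.+1 /\ forall j, P (xi i) j = v.[P (xi (inord 1)) j].

Definition P_polynomial_ordering_A1 (xi : 'S_d.+1) :=
  xi (inord 1) = inord 1 /\ P_polynomial_ordering xi.

Definition P_polynomial_wrt_A1 := exists xi, P_polynomial_ordering_A1 xi.

End PPolynomial.

Definition theta (R : realType) (d : nat) (P : 'I_d.+1 -> 'I_d.+1 -> R)
  (i : 'I_d.+1) : R := P (inord 1) i.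

Definition product_condition (R : realType) (d : nat)
    (P Q : 'I_d.+1 -> 'I_d.+1 -> R) (l : 'I_d.+1) :=
  forall i : 'I_d.+1, i != ord0 ->
    \prod_(j < d.+1 | (j != ord0) && (j != i))
      ((theta P ord0 - theta P j) / (theta P i - theta P j)) = - Q i l.

(* Main.v *)
Require Import Defs.
From HB Require Import structures.
From mathcomp Require Import all_boot all_order all_fingroup all_algebra.
From mathcomp Require Import reals.
Set Implicit Arguments.
Unset Strict Implicit.
Unset Printing Implicit Defensive.
Import GRing.Theory Num.Theory.
Local Open Scope ring_scope.

(** Write c_k(p) for the coefficient of A_k in p(A_1).  By Lagrange
    interpolation at theta_1, ..., theta_d, condition (2) for l says exactly
    that c_l(p) = 0 for all p of degree < d; equivalently, points in relation
    R_l are at distance at least d in the graph of A_1.  If the scheme is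
    P-polynomial, polynomials of degree < d are spanned by v_0, ..., v_(d-1),
    whence (2) for the last relation.  Conversely, theta being injective,
    every A_k is a polynomial of degree at most d in A_1, so R_l is at distance
    exactly d; the vertices of a geodesic show that each distance r <= d occurs,
    and since there are only d + 1 relations, each is attained by a single one,
    xi_r.  The interpolating polynomial of A_(xi_r) then has degree r, because
    if its degree is s, then A_(xi_s) occurs in it with nonzero coefficient. *)

(** * Lagrange interpolation over a finite index set *)

Section Lagrange.
Variables (F : fieldType) (I : finType) (A : {pred I}) (t : I -> F).
Hypothesis t_inj : injective t.

(** The scalars stay inside the product, so that evaluation yields factor by factor the quotients of
    condition (2). *)
Definition lagrange_basis (i : I) : {poly F} :=
  \prod_(j in A | j != i) ((t i - t j)^-1 *: ('X - (t j)%:P)).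

Lemma size_prod_XsubC_fin (B : {pred I}) :
  size (\prod_(j in B) ('X - (t j)%:P)) = #|B|.+1.
Proof. by rewrite -(big_enum _ _ B) /= size_prod_XsubC cardE. Qed.

Lemma horner_lagrange_basis i x :
  (lagrange_basis i).[x] = \prod_(j in A | j != i) ((x - t j) / (t i - t j)).
Proof.
rewrite horner_prod; apply: eq_bigr => j _.
by rewrite hornerZ hornerXsubC mulrC.
Qed.

Lemma lagrange_basis_node i k : k \in A ->
  (lagrange_basis i).[t k] = (i == k)%:R.
Proof.
move=> kA; rewrite horner_lagrange_basis; case: eqVneq => [->|nik] /=.
  apply: big1 => j /andP[_ njk]; rewrite divff // subr_eq0.
  by apply: contra njk => /eqP/t_inj ->.
by rewrite (bigD1 k) /= ?kA 1?eq_sym // subrr !mul0r.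
Qed.

Lemma size_lagrange_basis i : i \in A -> (size (lagrange_basis i) <= #|A|)%N.
Proof.
move=> iA; rewrite /lagrange_basis scaler_prod.
apply: leq_trans (size_scale_leq _ _) _.
rewrite (eq_bigl (mem [predD1 A & i])); last by move=> j; rewrite !inE andbC.
by rewrite size_prod_XsubC_fin (cardD1 i A) iA.
Qed.

Lemma size_lagrange_sum (f : I -> F) :
  (size (\sum_(i in A) f i *: lagrange_basis i)%R <= #|A|)%N.
Proof.
apply: leq_trans (size_sum _ _ _) _; apply/bigmax_leqP => i iA.
exact: leq_trans (size_scale_leq _ _) (size_lagrange_basis iA).
Qed.

Lemma lagrange_sum_node (f : I -> F) k : k \in A ->
  (\sum_(i in A) f i *: lagrange_basis i).[t k] = f k.
Proof.
move=> kA; rewrite horner_sum (bigD1 k) //= hornerZ lagrange_basis_node //.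
rewrite eqxx mulr1 big1 ?addr0 // => i /andP[_ nik].
by rewrite hornerZ lagrange_basis_node // (negbTE nik) mulr0.
Qed.

Lemma lagrange_interpolation (p : {poly F}) : (size p <= #|A|)%N ->
  p = \sum_(i in A) p.[t i] *: lagrange_basis i.
Proof.
move=> sp; apply/eqP; rewrite -subr_eq0; apply/eqP.
apply: (@roots_geq_poly_eq0 _ _ [seq t i | i <- enum A]).
- apply/allP => y /mapP[k]; rewrite mem_enum => kA ->.
  by rewrite /root hornerD hornerN lagrange_sum_node // subrr.
- by rewrite map_inj_uniq ?enum_uniq.
- rewrite size_map -cardE (leq_trans (size_polyD _ _)) //.
  by rewrite size_polyN geq_max sp size_lagrange_sum.
Qed.

End Lagrange.

(** * Polynomials in A_1 and their coefficients *)

Section Scheme.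
Variables (R : realType) (X : finType) (d : nat) (S : sym_assoc_scheme X d).
Variables (E : 'I_d.+1 -> 'M[R]_#|X|) (P Q : 'I_d.+1 -> 'I_d.+1 -> R).
Hypotheses (d_gt0 : (0 < d)%N) (hE : primitive_idempotents S E).
Hypotheses (hP : first_eigenmatrix S E P) (hQ : second_eigenmatrix S E Q).
Hypothesis theta_inj : injective (theta P).

Implicit Types (p q : {poly R}) (k l m : 'I_d.+1) (x y z : X) (r s : nat).

(** This is p(A_1) in spectral form, as A_1 is the sum of the [theta P i *: E i]. *)
Definition poly_mx p : 'M[R]_#|X| := \sum_i p.[theta P i] *: E i.

(** The number c_k(p), read off by expanding each E_i through [Q]. *)
Definition class_coef k p : R := #|X|%:R^-1 * \sum_i p.[theta P i] * Q i k.

Lemma scheme_relE k m x y : S k x y -> S m x y = (m == k).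
Proof.
move=> Sk; have [i [Si uniq_i]] := scheme_partition S x y.
apply/idP/eqP => [Sm|-> //].
by rewrite -(uniq_i _ Sm) (uniq_i _ Sk).
Qed.

Lemma scheme_relP x y : exists k, S k x y.
Proof. by have [k [Sk _]] := scheme_partition S x y; exists k. Qed.

Lemma adjacency_entry k x y :
  adjacency_mx R S k (enum_rank x) (enum_rank y) = (S k x y)%:R.
Proof. by rewrite mxE !enum_rankK. Qed.

Lemma card_points_neq0 : #|X|%:R != 0 :> R.
Proof.
have [x _] := scheme_nonempty S ord0.
by rewrite pnatr_eq0 -lt0n; apply/card_gt0P; exists x.
Qed.

Lemma idempotent_entry i k x y : S k x y ->
  E i (enum_rank x) (enum_rank y) = #|X|%:R^-1 * Q i k.
Proof.
move=> Sk; rewrite hQ mxE summxE (bigD1 k) //= mxE adjacency_entry Sk mulr1.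
rewrite big1 ?addr0 // => j njk.
by rewrite mxE adjacency_entry (scheme_relE _ Sk) (negbTE njk) mulr0.
Qed.

Lemma poly_mx_entry p k x y : S k x y ->
  poly_mx p (enum_rank x) (enum_rank y) = class_coef k p.
Proof.
move=> Sk; rewrite summxE /class_coef mulr_sumr; apply: eq_bigr => i _.
by rewrite mxE (idempotent_entry _ Sk) mulrCA.
Qed.

Lemma class_coef_sum k p :
  class_coef k p = \sum_(s < size p) p`_s * class_coef k 'X^s.
Proof.
rewrite /class_coef mulr_sumr.
under eq_bigr do rewrite horner_coef mulr_suml mulr_sumr.
rewrite exchange_big /=; apply: eq_bigr => s _.
rewrite mulrCA mulr_sumr mulr_sumr; apply: eq_bigr => i _.
by rewrite hornerXn !mulrA.
Qed.

Lemma class_coefB k p q : class_coef k (p - q) = class_coef k p - class_coef k q.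
Proof.
rewrite /class_coef.
under eq_bigr do rewrite hornerD hornerN mulrBl.
by rewrite sumrB mulrBr.
Qed.

Lemma class_coefZ k a p : class_coef k (a *: p) = a * class_coef k p.
Proof.
rewrite /class_coef.
under eq_bigr do rewrite hornerZ -mulrA.
by rewrite -mulr_sumr mulrCA.
Qed.

Lemma class_coef_adjacency p m k : poly_mx p = adjacency_mx R S m ->
  class_coef k p = (m == k)%:R.
Proof.
move=> pm; have [x [y Sk]] := scheme_nonempty S k.
by rewrite -(poly_mx_entry p Sk) pm adjacency_entry (scheme_relE _ Sk).
Qed.

Lemma class_coef_P p m k : (forall j, P m j = p.[theta P j]) ->
  class_coef k p = (m == k)%:R.
Proof.
move=> pm; apply: class_coef_adjacency; rewrite hP.
by apply: eq_bigr => j _; rewrite pm.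
Qed.

Lemma poly_mx1 : poly_mx 1 = 1%:M.
Proof.
rewrite -(pidem_sum hE); apply: eq_bigr => i _.
by rewrite hornerC scale1r.
Qed.

Lemma adjacency_mx0 : adjacency_mx R S ord0 = 1%:M.
Proof.
apply/matrixP => i j.
by rewrite !mxE scheme_diag (inj_eq enum_val_inj).
Qed.

Lemma class_coef1 k : class_coef k 1 = (ord0 == k)%:R.
Proof. by apply: class_coef_adjacency; rewrite poly_mx1 adjacency_mx0. Qed.

Lemma class_coefX k : class_coef k 'X = (inord 1 == k)%:R.
Proof. by apply: class_coef_P => j; rewrite hornerX. Qed.

Lemma Q0 k : Q ord0 k = 1.
Proof.
have [x [y Sk]] := scheme_nonempty S k.
have := idempotent_entry ord0 Sk; rewrite (pidem0 hE) !mxE => /mulfI <- //.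
by rewrite invr_eq0 card_points_neq0.
Qed.

(** * Powers of A_1 and distances in its graph *)

Lemma poly_mxXS r :
  poly_mx 'X^(r.+1) = adjacency_mx R S (inord 1) *m poly_mx 'X^r.
Proof.
rewrite hP mulmx_suml; apply: eq_bigr => i _.
rewrite mulmx_sumr (bigD1 i) //= -scalemxAl -scalemxAr (pidem_orth hE) eqxx.
rewrite big1 ?addr0 => [|j nji].
  by rewrite scalerA !hornerXn exprS.
by rewrite -scalemxAl -scalemxAr (pidem_orth hE) eq_sym (negbTE nji) !scaler0.
Qed.

Lemma poly_mxXS_entry r x y :
  poly_mx 'X^(r.+1) (enum_rank x) (enum_rank y) =
  \sum_z (S (inord 1) x z)%:R * poly_mx 'X^r (enum_rank z) (enum_rank y).
Proof.
rewrite poly_mxXS mxE (reindex enum_rank) /=; last exact/onW_bij/enum_rank_bij.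
by apply: eq_bigr => z _; rewrite adjacency_entry.
Qed.

(** The entries count walks of length r; their sign later makes a vanishing sum vanish term by
    term. *)
Lemma poly_mxX_ge0 r x y : 0 <= poly_mx 'X^r (enum_rank x) (enum_rank y).
Proof.
elim: r x => [|r IHr] x; first by rewrite expr0 poly_mx1 mxE ler0n.
by rewrite poly_mxXS_entry sumr_ge0 // => z _; rewrite mulr_ge0 ?ler0n.
Qed.

(* Points in relation [k] are at distance [r] in the graph of [R_1]. *)
Definition at_distance k r :=
  class_coef k 'X^r != 0 /\ forall s, (s < r)%N -> class_coef k 'X^s = 0.

Lemma at_distance_uniq k r s : at_distance k r -> at_distance k s -> r = s.
Proof.
move=> [r_neq0 r_min] [s_neq0 s_min]; case: (ltngtP r s) => // lt_rs.
  by rewrite s_min ?eqxx in r_neq0.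
by rewrite r_min ?eqxx in s_neq0.
Qed.

(** The first step of a geodesic from x to y leads to a vertex z at distance r from y; k' is the
    relation of z and y. *)
Lemma at_distance_pred k r : at_distance k r.+1 -> exists k', at_distance k' r.
Proof.
move=> [kr_neq0 kr_min]; have [x [y Sk]] := scheme_nonempty S k.
have /existsP[z /andP[xz zy]] : [exists z, S (inord 1) x z &&
    (poly_mx 'X^r (enum_rank z) (enum_rank y) != 0)].
  apply: contraR kr_neq0 => /existsPn no_z.
  rewrite -(poly_mx_entry _ Sk) poly_mxXS_entry big1 // => z _.
  have := no_z z; rewrite negb_and negbK.
  by case: (S _ x z) => /= [/eqP ->|_]; rewrite ?mulr0 ?mul0r.
have [k' Sk'] := scheme_relP z y; exists k'.
split=> [|s lt_sr]; first by rewrite -(poly_mx_entry _ Sk').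
(* A walk of length s from z to y would extend through the edge from x to z to a walk of length s+1
   < r+1 from x to y. *)
have /eqP := kr_min s.+1 lt_sr.
rewrite -(poly_mx_entry _ Sk) -(poly_mx_entry _ Sk') poly_mxXS_entry.
rewrite psumr_eq0 => [/allP/(_ z (mem_index_enum z))|z' _]; last first.
  by rewrite mulr_ge0 ?ler0n ?poly_mxX_ge0.
by rewrite xz mul1r => /eqP.
Qed.

(** * Condition (2) and polynomials of degree below d *)

Lemma P_interpolation k : exists2 p : {poly R},
  (size p <= d.+1)%N & forall j, P k j = p.[theta P j].
Proof.
exists (\sum_(i in 'I_d.+1) P k i *: lagrange_basis 'I_d.+1 (theta P) i).
  by rewrite -[X in (_ <= X)%N]card_ord size_lagrange_sum.
by move=> j; rewrite lagrange_sum_node.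
Qed.

Lemma product_conditionP l : product_condition P Q l <->
  forall p, (size p <= d)%N -> class_coef l p = 0.
Proof.
have cardB : #|predC1 (ord0 : 'I_d.+1)| = d.
  by rewrite cardC1 card_ord.
split=> [hl p sp|hl i i_neq0].
  rewrite -cardB in sp.
  rewrite /class_coef (bigD1 ord0) //= Q0 mulr1.
  (* Only p(theta_0) is expanded; by (2) it becomes minus the sum of the p(theta_i) Q_i(l) over i !=
     0, which cancels the other terms. *)
  rewrite {1}(lagrange_interpolation theta_inj sp) horner_sum -big_split /=.
  rewrite big1 ?mulr0 // => i i_neq0; rewrite hornerZ horner_lagrange_basis.
  under eq_bigl do rewrite inE.
  by rewrite hl // mulrN addNr.
(* The test polynomial of degree d-1 vanishes at every theta_j except theta_0 and theta_i, so c_l(p)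
   = 0 reads p(theta_0) = - p(theta_i) Q_i(l). *)
pose B := [predD1 predC1 (ord0 : 'I_d.+1) & i].
have cardB' : #|B|.+1 = d by have := cardB; rewrite (cardD1 i) inE i_neq0.
pose p : {poly R} := \prod_(j in B) ('X - (theta P j)%:P).
have p_root j : j \in B -> p.[theta P j] = 0.
  by move=> jB; rewrite horner_prod (bigD1 j) //= hornerXsubC subrr mul0r.
have pi_neq0 : p.[theta P i] != 0.
  rewrite horner_prod; apply/prodf_neq0 => j; rewrite !inE => /andP[nji _].
  rewrite hornerXsubC subr_eq0; apply: contra nji => /eqP/theta_inj ->.
  exact: eqxx.
have := hl p; rewrite size_prod_XsubC_fin cardB' => /(_ (leqnn d)).
move/eqP; rewrite mulf_eq0 invr_eq0 (negbTE card_points_neq0) /=.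
rewrite (bigD1 ord0) //= (bigD1 i) //= Q0 mulr1 big1 ?addr0; last first.
  by move=> j /andP[j0 ji]; rewrite p_root ?mul0r // !inE ji.
rewrite addr_eq0 -mulrN => /eqP p0.
have pE (a : R) :
  p.[a] = \prod_(j | (j != ord0) && (j != i)) (a - theta P j).
  rewrite horner_prod; apply: eq_big => j; first by rewrite !inE andbC.
  by rewrite hornerXsubC.
by rewrite big_split /= prodfV -!pE p0 mulrAC divff ?mul1r.
Qed.

(** Induction on the degree: the leading term of p is removed by a multiple of the v of equal
    degree, and v(A_1) is a class other than the last one. *)
Lemma P_polynomial_max_class xi p : P_polynomial_ordering_A1 P xi ->
  (size p <= d)%N -> class_coef (xi ord_max) p = 0.
Proof.
move=> [xi1 [_ hv]]; rewrite xi1 in hv.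
have [n] := ubnP (size p); elim: n p => // n IHn p lt_pn le_pd.
have [->|p_neq0] := eqVneq p 0.
  by rewrite -(scale0r (0 : {poly R})) class_coefZ mul0r.
have sp_gt0 : (0 < size p)%N by rewrite size_poly_gt0.
have lt_i : ((size p).-1 < d.+1)%N by rewrite prednK // ltnW.
have [v [sv Pv]] := hv (Ordinal lt_i); rewrite /= prednK // in sv.
have v_neq0 : lead_coef v != 0 by rewrite lead_coef_eq0 -size_poly_gt0 sv.
pose a := lead_coef p / lead_coef v.
have cv : class_coef (xi ord_max) v = 0.
  rewrite (class_coef_P _ Pv) (inj_eq perm_inj) -val_eqE /= ltn_eqF //.
  by rewrite prednK.
suff lt_q : (size (p - a *: v)%R < size p)%N.
  have := IHn (p - a *: v); rewrite class_coefB class_coefZ cv mulr0 subr0.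
  apply; first exact: leq_trans lt_q _.
  exact: leq_trans (ltnW lt_q) le_pd.
rewrite -[X in (_ < X)%N](prednK sp_gt0) ltnS; apply/leq_sizeP => j.
rewrite leq_eqVlt coefB coefZ => /predU1P[<-|].
  by rewrite -{2}sv -!lead_coefE /a divfK // subrr.
rewrite prednK // => le_j.
by rewrite !nth_default ?sv // mulr0 subrr.
Qed.

(** * From condition (2) to a P-polynomial ordering *)

Lemma at_distance_max l : product_condition P Q l -> at_distance l d.
Proof.
move=> /product_conditionP hl; split=> [|s lt_sd]; last first.
  by apply: hl; rewrite size_polyXn.
have [p sp Pp] := P_interpolation l.
have := class_coef_P l Pp; rewrite eqxx class_coef_sum => cp.
(* Lower powers contribute nothing to the coefficient 1 of A_l, so X^d must. *)
apply: contra_eq_neq cp => cd.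
rewrite big1 1?eq_sym ?oner_eq0 // => s _.
have: (s <= d)%N by rewrite -ltnS (leq_trans (ltn_ord s)).
rewrite leq_eqVlt => /predU1P[->|lt_sd]; first by rewrite cd mulr0.
by rewrite hl ?mulr0 // size_polyXn.
Qed.

Lemma product_condition_P_polynomial l :
  product_condition P Q l -> P_polynomial_wrt_A1 P.
Proof.
move=> /at_distance_max hl.
have dist_onto r : (r <= d)%N -> exists k, at_distance k r.
  move=> le_rd; rewrite -(subKn le_rd).
  elim: (d - r)%N => [|n [k]]; first by exists l; rewrite subn0.
  case: (ltnP n d) => [lt_nd|le_dn].
    by rewrite -subSS subSn //; apply: at_distance_pred.
  (* Subtraction is truncated: here [d - n] and [d - n.+1] are both 0. *)
  move=> hk; exists k; move: hk; congr (at_distance _ _).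
  by rewrite (eqP le_dn); apply/esym/eqP/leqW.
have /fin_all_exists[f hf] (r : 'I_d.+1) : exists k, at_distance k r.
  by apply: dist_onto; rewrite -ltnS.
have f_inj : injective f.
  move=> r s frs; apply/val_inj/(at_distance_uniq (hf r)).
  by rewrite frs; apply: hf.
(* Only A_1 has a nonzero coefficient in X; [d_gt0] makes [inord 1] the index 1. *)
have f1 : f (inord 1) = inord 1.
  have [] := hf (inord 1); rewrite inordK // expr1 class_coefX pnatr_eq0 eqb0.
  by rewrite negbK => /eqP.
exists (perm f_inj); split; rewrite ?permE //; split.
  have [] := hf ord0; rewrite expr0 class_coef1 pnatr_eq0 eqb0 negbK permE.
  by move=> /eqP.
move=> r; have [p sp Pp] := P_interpolation (f r); exists p.
rewrite !permE f1; split=> //.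
have p_neq0 : p != 0.
  apply/eqP => p0; have := class_coef_P (f r) Pp.
  rewrite p0 eqxx class_coef_sum size_poly0 big_ord0 => /eqP.
  by rewrite eq_sym oner_eq0.
have sp_gt0 : (0 < size p)%N by rewrite size_poly_gt0.
have lt_s : ((size p).-1 < d.+1)%N by rewrite prednK.
pose s := Ordinal lt_s; have [s_neq0 s_min] := hf s.
suff -> : r = s by rewrite /= prednK.
(* The coefficient of A_(f s) in p(A_1) reduces to its top term, which is nonzero; as p(A_1) = A_(f
   r), this forces f r = f s. *)
apply/f_inj/eqP; have := class_coef_P (f s) Pp.
rewrite class_coef_sum -(prednK sp_gt0) big_ord_recr /= big1 ?add0r; last first.
  by move=> j _; rewrite s_min ?mulr0.
case: eqP => // _ /eqP; rewrite mulf_eq0 (negbTE s_neq0) orbF -lead_coefE.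
by rewrite lead_coef_eq0 (negbTE p_neq0).
Qed.

End Scheme.

Theorem theorem1p1 (R : realType) (X : finType) (d : nat) (hd : (0 < d)%N)
    (S : sym_assoc_scheme X d) (E : 'I_d.+1 -> 'M[R]_#|X|)
    (P Q : 'I_d.+1 -> 'I_d.+1 -> R)
    (hE : primitive_idempotents S E)
    (hP : first_eigenmatrix S E P) (hQ : second_eigenmatrix S E Q)
    (htheta : injective (theta P)) :
  (P_polynomial_wrt_A1 P <-> exists l : 'I_d.+1, product_condition P Q l) /\
  (forall l : 'I_d.+1, product_condition P Q l ->
     forall xi : 'S_d.+1, P_polynomial_ordering_A1 P xi -> xi ord_max = l).
Proof.
have condP l := product_conditionP hE hQ htheta l.
split; [split=> [[xi hxi]|[l hl]]|].
- by exists (xi ord_max); apply/condP => p; apply: P_polynomial_max_class hxi.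
- exact: (product_condition_P_polynomial hd hE hP hQ htheta hl).
move=> l /condP hl xi [xi1 [_ hv]]; rewrite xi1 in hv.
(* If l had position below d, its polynomial v would have degree below d, and (2) would turn the
   coefficient 1 of A_l into 0. *)
have [v [sv Pv]] := hv ((xi^-1)%g l); rewrite permKV in Pv.
have := class_coef_P hP hQ l Pv; rewrite eqxx => cv.
have [lt_id|] := ltnP ((xi^-1)%g l) d.
  by have /eqP := cv; rewrite hl ?sv // eq_sym oner_eq0.
move=> le_di; apply: (canLR (permKV xi)); apply: val_inj => /=.
by apply/eqP; rewrite eqn_leq le_di -ltnS ltn_ord.
Qed.
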